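(* Let $k\geq 2$ be an integer, let $a>\frac12(k-1)$ be real, and let $\widetilde{A}=(\widetilde{a}_{ij})_{k\times k}$ be the symmetric matrix with entries $$\widetilde{a}_{k,k-1}=\widetilde{a}_{k-1,k}=k-1-a,\qquad \widetilde{a}_{k-1,k-1}=\widetilde{a}_{k,k}=a,$$ $$\widetilde{a}_{i,k-1}=\widetilde{a}_{i,k}=\widetilde{a}_{k-1,i}=\widetilde{a}_{k,i}=i\quad(1\le i\le k-2),\qquad \widetilde{a}_{ij}=2\min(i,j)\quad(1\le i,j\le k-2).$$ Then $\widetilde{A}$ is positive definite, and for every $x\neq 0$ $$\sum_{\substack{n=(n_1,\dots,n_k)^{\mathrm T}\in\mathbb{N}^k\\ n_{k-1}\equiv n_k \pmod 2}}\frac{q^{\frac12 n^{\mathrm T}\widetilde{A}n}x^{n_{k-1}-n_k}}{(q;q)_{n_1}\cdots(q;q)_{n_k}}=\frac{(-q^{2a}x^2,-q^{2a}x^{-2},q^{4a};q^{4a})_\infty}{(q;q)_\infty},$$ $$\sum_{\substack{n=(n_1,\dots,n_k)^{\mathrm T}\in\mathbb{N}^k\\ n_{k-1}\not\equiv n_k \pmod 2}}\frac{q^{\frac12 n^{\mathrm T}\widetilde{A}n}x^{n_{k-1}-n_k}}{(q;q)_{n_1}\cdots(q;q)_{n_k}}=q^{\frac12 a}x\,\frac{(-q^{4a}x^2,-x^{-2},q^{4a};q^{4a})_\infty}{(q;q)_\infty},$$ and $$\sum_{n=(n_1,\dots,n_k)^{\mathrm T}\in\mathbb{N}^k}\frac{q^{\frac12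 n^{\mathrm T}\widetilde{A}n}x^{n_{k-1}-n_k}}{(q;q)_{n_1}\cdots(q;q)_{n_k}}=\frac{(-xq^{a/2},-q^{a/2}x^{-1},q^a;q^a)_\infty}{(q;q)_\infty}.$$
   Context: Here $q=e^{2\pi i\tau}$ with $\mathrm{Im}\,\tau>0$ (so $0<|q|<1$), real powers mean $q^{r}=e^{2\pi i r\tau}$, and $x$ is a nonzero complex number. $\mathbb{N}=\{0,1,2,\dots\}$. For $n\in\mathbb{N}\cup\{\infty\}$, $(b;q)_n=\prod_{j=0}^{n-1}(1-bq^j)$ and $(b_1,\dots,b_m;q)_n=\prod_{j=1}^m(b_j;q)_n$; similarly with base $q^{a}$ or $q^{4a}$ in place of $q$. When $k=2$ the conditions with $1\le i\le k-2$ are vacuous, and $\widetilde A=\begin{pmatrix}a&1-a\\1-a&a\end{pmatrix}$. *)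

(* Defs.v *)
From HB Require Import structures.
From mathcomp Require Import all_boot all_order all_algebra.
From mathcomp Require Import finmap.
From mathcomp Require Import complex.
From mathcomp Require Import all_classical all_reals all_analysis.
From mathcomp Require Import showcase.summability.
Set Implicit Arguments.
Unset Strict Implicit.
Unset Printing Implicit Defensive.
Import Order.TTheory GRing.Theory Num.Theory.
Import numFieldNormedType.Exports.
Local Open Scope classical_set_scope.
Local Open Scope ring_scope.
Local Open Scope complex_scope.

(* Unordered sum: convergence of the net of finite partial sums indexed by the
   finite subsets of I.  In a finite-dimensional space this amounts to absolute
   convergence with sum s. *)
Definition has_sum (I : choiceType) (K : numDomainType) (V : normedModType K)
    (D : pred I) (f : I -> V) (s : V) : Prop :=
  (fun A : {fset I} => \sum_(i <- A | D i) f i) @ totally --> s.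

Definition posdef (R : realType) (k : nat) (A : 'M[R]_k) : Prop :=
  A^T = A /\ forall v : 'cV[R]_k, v != 0 -> 0 < (v^T *m A *m v) 0 0.

Section QSeries.
Variable R : realType.

(* R[i] itself carries no topology: limits are taken in its regular module
   R[i]^o, a normed module over R[i] whose topology is given by the modulus. *)

Definition cexp (z : R[i]) : R[i] :=
  (expR (complex.Re z))%:C * (cos (complex.Im z) +i* sin (complex.Im z)).

(* q^r = exp (2 pi i r tau); q itself is qpow tau 1. *)
Definition qpow (tau : R[i]) (r : R) : R[i] :=
  cexp ((2 * pi * r)%:C * (0 +i* 1) * tau).

Definition qpoch (b q : R[i]) (n : nat) : R[i] :=
  \prod_(j < n) (1 - b * q ^+ j).

Definition qpoch_inf (b q : R[i]) : R[i] :=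
  limn (qpoch b q : nat -> R[i]^o).

Definition qpochs_inf (bs : seq R[i]) (q : R[i]) : R[i] :=
  \prod_(b <- bs) qpoch_inf b q.

(* The indices i, j are 1-based, as in the paper: 1 <= i, j <= k. *)
Definition Atilde_entry (k : nat) (a : R) (i j : nat) : R :=
  if (i <= k - 2)%N && (j <= k - 2)%N then (2 * minn i j)%:R
  else if (i <= k - 2)%N then i%:R
  else if (j <= k - 2)%N then j%:R
  else if i == j then a
  else (k - 1)%:R - a.

Definition Atilde (k : nat) (a : R) : 'M[R]_k :=
  \matrix_(i < k, j < k) Atilde_entry k a i.+1 j.+1.

Definition coord1 (k : nat) (n : k.-tuple nat) (i : nat) : nat :=
  nth 0%N n i.-1.

Definition quadform (k : nat) (A : 'M[R]_k) (n : k.-tuple nat) : R :=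
  let v : 'cV[R]_k := \col_(i < k) (tnth n i)%:R in (v^T *m A *m v) 0 0.

Definition summand (k : nat) (a : R) (tau x : R[i]) (n : k.-tuple nat) :
    R[i]^o :=
  qpow tau (2^-1 * quadform (Atilde k a) n)
  * x ^ ((coord1 n (k - 1))%:Z - (coord1 n k)%:Z)
  / \prod_(i < k) qpoch (qpow tau 1) (qpow tau 1) (tnth n i).

End QSeries.

(* Main.v *)
Require Import Defs.
From HB Require Import structures.
From mathcomp Require Import all_boot all_order all_algebra.
From mathcomp Require Import finmap.
From mathcomp Require Import complex.
From mathcomp Require Import all_classical all_reals all_analysis.
From mathcomp Require Import showcase.summability.
From mathcomp Require Import ring zify.
Import Order.TTheory GRing.Theory Num.Theory.
Import numFieldNormedType.Exports.
Local Open Scope classical_set_scope.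
Local Open Scope ring_scope.
Local Open Scope complex_scope.
Set Implicit Arguments.
Unset Strict Implicit.
Unset Printing Implicit Defensive.

(** Write u and v for the last two coordinates of n, m = u - v, and
N_i = n_i + ... + n_{k-2}.  Completing the quadratic form gives
  (1/2) n^T A n = (a/2) m^2 + u v + sum_{i <= k-2} (N_i + u)(N_i + v),
so the real parameter a only enters through the weight q^(a m^2 / 2) x^m,
which depends on n through m alone ([quadform_Atilde], [summand_nahm_term]).

For any absolutely summable weight w on the integers, the sum of
w(u - v) q^(u v + sum_i (N_i + u)(N_i + v)) / prod (q; q)_{n_i} equals
(sum_m w(m)) / (q; q)_oo ([has_sum_nahm]).  Indeed, with r = n_{k-2}, the
q-Vandermonde identity
  sum_r q^((U-r)(V-r)) / ((q)_r (q)_{U-r} (q)_{V-r}) = 1 / ((q)_U (q)_V)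
sums the terms having u + r = U and v + r = V; the result is the same summand
with one coordinate fewer, and U - V = u - v is unchanged.  Repeating this
leaves a double sum over (u, v), and for each value of u - v the limiting case
  sum_s q^(s (s+m)) / ((q)_s (q)_{s+m}) = 1 / (q)_oo
(dissection of partitions by Durfee rectangles, [has_sum_durfee]) finishes.

The remaining sum over m of q^(a m^2 / 2) x^m, over all integers, over the even
ones or over the odd ones, is a theta series, and the Jacobi triple product
([has_sum_jacobi]) evaluates it.

Two analytic tools carry the rearrangements.  A family with bounded sums of
moduli may be summed along the fibers of a map ([has_sum_fibers]); boundedness
is obtained by running the same fiberwise argument on the majorant in which q
and w are replaced by their moduli, where every term is nonnegative
([bounded_sums_fibers], [bounded_nahm]).  The infinite identities are termwise
limits of finite ones under a dominating bound ([has_sum_tannery]).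

Positive definiteness follows from the same completion of squares, arranged as
a sum of squares with coefficients a - (k-1)/2, 1/2 and 2
([Atilde_form_squares]). *)

(** * Unordered sums of complex families *)

Section UnorderedSums.
Variable R : realType.
Local Notation C := R[i].
Implicit Types (I J : choiceType).

Lemma has_sumP I (D : pred I) (f : I -> C^o) (s : C^o) :
  has_sum D f s <->
  forall e : C, 0 < e -> exists A0 : {fset I}, forall A : {fset I},
    (A0 `<=` A)%fset -> `|s - \sum_(i <- A | D i) f i| <= e.
Proof.
have F := @totally_filter I; rewrite /has_sum; split.
  move=> /cvgrPdist_le h e e0; have [A _ hA] := h e e0.
  by exists A => B /hA.
move=> h; apply/cvgrPdist_le => e e0; have [A hA] := h e e0.
by exists A => // B /hA.
Qed.

(** The general lemmas on limits of products and inverses are stated for the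
topology of an abstract numeric field; these two restate them over the regular
module, where the unordered sums live. *)
Lemma cvgMC (u v : nat -> C^o) (a b : C^o) :
  u @ \oo --> a -> v @ \oo --> b -> (u n * v n : C^o) @[n --> \oo] --> (a * b : C^o).
Proof. by move=> ua vb; exact: (@cvgM C _ _ _ u v a b ua vb). Qed.

Lemma cvgVC (u : nat -> C^o) (a : C^o) :
  a != 0 -> u @ \oo --> a -> ((u n)^-1 : C^o) @[n --> \oo] --> (a^-1 : C^o).
Proof. by move=> a0 ua; exact: (@cvgV C _ _ _ u a a0 ua). Qed.

Lemma cvg_ge_subseq (u : nat -> C^o) (l : C^o) (phi : nat -> nat) :
  (forall n, (n <= phi n)%N) -> u @ \oo --> l -> (u (phi n) : C^o) @[n --> \oo] --> l.
Proof.
move=> hphi /cvgrPdist_le h; apply/cvgrPdist_le => e /h[N _ hN].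
by exists N => // n /= Nn; apply: hN; rewrite /= (leq_trans Nn).
Qed.

Lemma has_sum_mkcond I (D : pred I) (f : I -> C^o) (s : C^o) :
  has_sum xpredT (fun i => if D i then f i else 0) s -> has_sum D f s.
Proof.
rewrite /has_sum; under eq_fun do rewrite -big_mkcond; exact.
Qed.

Lemma eq_has_sum I (f g : I -> C^o) (s t : C^o) :
  f =1 g -> s = t -> has_sum xpredT f s -> has_sum xpredT g t.
Proof. by move=> fg <-; have -> : f = g by apply/funext. Qed.

Lemma big_fset_split I (A B : {fset I}) (f : I -> C) : (A `<=` B)%fset ->
  \sum_(i <- B) f i = \sum_(i <- A) f i + \sum_(i <- (B `\` A)%fset) f i.
Proof.
move=> AB; rewrite (big_fsetID _ (mem A)) /=; congr (_ + _).
  apply: eq_fbigl => i; rewrite !inE /=.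
  by apply/andP/idP => [[] //|iA]; split => //; exact: (fsubsetP AB).
by apply: eq_fbigl => i; rewrite !inE /= andbC.
Qed.

(** Absolute summability, in the form that passes through rearrangements
without naming the value of the sum. *)
Definition bounded_sums I (f : I -> C) :=
  exists M : C, forall A : {fset I}, \sum_(i <- A) `|f i| <= M.

Lemma le_bounded_sums I (f g : I -> C) :
  (forall i, `|f i| <= `|g i|) -> bounded_sums g -> bounded_sums f.
Proof.
move=> fg [M gM]; exists M => A; apply: le_trans (gM A).
by apply: ler_sum => i _; exact: fg.
Qed.

Lemma bounded_sumsZ I (c : C) (f : I -> C) :
  bounded_sums f -> bounded_sums (fun i => c * f i).
Proof.
move=> [M fM]; exists (`|c| * M) => A.
under eq_bigr do rewrite normrM.
by rewrite -mulr_sumr ler_wpM2l.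
Qed.

Lemma bounded_sums_norm I (f g : I -> C) :
  (forall i, `|f i| <= g i) -> bounded_sums g -> bounded_sums f.
Proof.
move=> fg; apply: le_bounded_sums => i.
by apply: le_trans (fg i) _; rewrite ger0_norm// (le_trans _ (fg i)).
Qed.

Lemma bounded_sums_seq I (f : I -> C) (r : nat -> seq I) (M : C) :
  (forall n, uniq (r n)) ->
  (forall A : {fset I}, exists n, forall i, i \in A -> i \in r n) ->
  (forall n, \sum_(i <- r n) `|f i| <= M) -> bounded_sums f.
Proof.
move=> ur Ar hM; exists M => A; have [n An] := Ar A.
apply: le_trans (hM n).
have -> : \sum_(i <- r n) `|f i| = \sum_(i <- [fset i in r n]%fset) `|f i|.
  by apply: perm_big; apply: uniq_perm => // i; rewrite !inE.
have AB : (A `<=` [fset i in r n])%fset by apply/fsubsetP => i /An; rewrite inE.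
by rewrite (big_fset_split _ AB) lerDl sumr_ge0.
Qed.

(** Otherwise disjoint finite sets, each contributing more than e, could be
collected forever, and their union would exceed any bound. *)
Lemma small_tails I (f : I -> C) : bounded_sums f ->
  forall e : C, 0 < e -> exists A0 : {fset I}, forall A : {fset I},
    [disjoint A & A0]%fset -> \sum_(i <- A) `|f i| <= e.
Proof.
move=> [M fM] e e0; apply: contrapT => /forallNP noA0.
have big n : exists A : {fset I}, n%:R * e <= \sum_(i <- A) `|f i|.
  elim: n => [|n [A hA]].
    by exists fset0; rewrite mul0r sumr_ge0.
  have /existsNP[B /not_implyP[dAB /negP hB]] := noA0 A.
  exists (A `|` B)%fset.
  rewrite (@big_fset_split _ A) ?fsubsetUl// -natr1 mulrDl mul1r lerD//.
  have -> : ((A `|` B) `\` A = B)%fset.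
    apply/fsetP => i; rewrite !inE; case: (boolP (i \in A)) => //= iA.
    by apply/esym/negP => iB; move/fdisjointP : dAB => /(_ _ iB); rewrite iA.
  move: hB; rewrite -real_ltNge ?ger0_real ?sumr_ge0 ?(ltW e0)//.
  exact: ltW.
have [e' ee'] : exists e' : R, e = e'%:C.
  by exists (complex.Re e); rewrite RRe_real// ger0_real// ltW.
have e'0 : 0 < e' by move: e0; rewrite ee' ltcR.
have [A hA] := big (Num.bound `|complex.Re M / e'|).
have := le_trans hA (fM A).
rewrite ee' -(rmorph_nat (real_complex R)) -rmorphM lecE /= => /andP[_].
rewrite leNgt => /negP; apply.
rewrite -ltr_pdivrMr//; apply: le_lt_trans (ler_norm _) _.
by apply: archi_boundP.
Qed.

Lemma has_sum_finite I (r : seq I) (f : I -> C^o) : uniq r ->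
  (forall i, i \notin r -> f i = 0) ->
  has_sum xpredT f (\sum_(i <- r) f i).
Proof.
move=> ur f0; apply/has_sumP => e e0; exists [fset i in r]%fset => A rA.
rewrite (big_fset_split _ rA) [X in _ - (_ + X)]big1_fset ?addr0; last first.
  by move=> i; rewrite !inE => /andP[+ _] _; exact: f0.
rewrite (perm_big [fset i in r]%fset) /= ?subrr ?normr0 ?ltW//.
by apply: uniq_perm => // i; rewrite !inE.
Qed.

Lemma has_sumZ I (c : C) (f : I -> C^o) (s : C^o) :
  has_sum xpredT f s -> has_sum xpredT (fun i => c * f i : C^o) (c * s).
Proof.
move=> /has_sumP fs; apply/has_sumP => e e0.
have [->|c0] := eqVneq c 0.
  exists fset0 => A _; rewrite mul0r big1 ?subrr ?normr0 ?ltW// => i _.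
  by rewrite mul0r.
have nc0 : 0 < `|c| by rewrite normr_gt0.
have [A0 hA0] := fs (e / `|c|) (divr_gt0 e0 nc0).
exists A0 => A /hA0 hA.
by rewrite -mulr_sumr -mulrBr normrM mulrC -ler_pdivlMr.
Qed.

Lemma sum_image_fiber I J (g : I -> J) (A : {fset I}) (K : {fset J}) (f : I -> C) :
  (forall i, i \in A -> g i \in K) ->
  \sum_(i <- A) f i = \sum_(j <- K) \sum_(i <- A | g i == j) f i.
Proof.
move=> gK; rewrite (exchange_big_dep xpredT)//= big_seq [RHS]big_seq.
apply: eq_bigr => i /gK giK.
rewrite -big_filter (perm_big [:: g i]) ?big_seq1//.
apply: uniq_perm => // [|j]; first by rewrite filter_uniq// fset_uniq.
by rewrite mem_filter inE eq_sym; case: eqVneq => //= ->.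
Qed.

(** Summation by packets.  A finite set that nearly exhausts finitely many
fibers gives a partial sum close to s; any two finite sets containing the set
beyond which the moduli are negligible give nearby partial sums. *)
Lemma has_sum_fibers I J (g : I -> J) (f : I -> C^o) (F : J -> C^o) (s : C^o) :
  bounded_sums f ->
  (forall j, has_sum xpredT (fun i => if g i == j then f i else 0 : C^o) (F j)) ->
  has_sum xpredT F s -> has_sum xpredT f s.
Proof.
move=> bf hF /has_sumP hs; apply/has_sumP => e e0.
have e30 : 0 < e / 4 by rewrite divr_gt0.
have [A0 hA0] := small_tails bf e30.
have [J0 hJ0] := hs _ e30.
pose K := (J0 `|` [fset g i | i in A0])%fset.
(* The error e / 4 is shared between the fibers over K; the successor keeps
   the denominator nonzero when K is empty. *)
pose d := e / 4 / (size K).+1%:R.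
have d0 : 0 < d by rewrite divr_gt0.
have /choice[B hB] : forall j, exists B : {fset I}, forall A : {fset I},
    (B `<=` A)%fset -> `|F j - \sum_(i <- A | g i == j) f i| <= d.
  move=> j; have /has_sumP/(_ d d0)[B hB] := hF j; exists B => A /hB.
  by rewrite -big_mkcond.
pose U := (A0 `|` \bigcup_(j <- K) B j)%fset.
(* Dropping the points over the complement of K leaves exactly the fibers
   that are under control. *)
pose V := [fset i in U | g i \in K]%fset.
have A0V : (A0 `<=` V)%fset.
  apply/fsubsetP => i iA0; rewrite !inE /= iA0 /=; apply/orP; right.
  by apply/imfsetP; exists i.
(* All partial sums beyond A0 agree up to e / 4. *)
have close A : (A0 `<=` A)%fset ->
    `|\sum_(i <- A) f i - \sum_(i <- A0) f i| <= e / 4.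
  move=> AA; rewrite (big_fset_split _ AA) addrC addKr.
  apply: le_trans (ler_norm_sum _ _ _) _; apply: hA0.
  by apply/fdisjointP => i; rewrite !inE => /andP[].
exists A0 => A AA.
have hsV : `|s - \sum_(i <- V) f i| <= e / 4 + e / 4.
  rewrite (@sum_image_fiber _ _ g V K); last by move=> i; rewrite !inE => /andP[].
  rewrite -(subrKA (\sum_(j <- K) F j)).
  apply: le_trans (ler_normD _ _) (lerD _ _).
    by apply: hJ0; rewrite fsubsetUl.
  rewrite -sumrB; apply: le_trans (ler_norm_sum _ _ _) _.
  apply: (@le_trans _ _ (\sum_(j <- K) d)).
    rewrite big_seq [leRHS]big_seq; apply: ler_sum => j jK.
    have -> : \sum_(i <- V | g i == j) f i = \sum_(i <- U | g i == j) f i.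
      apply: eq_fbigl_cond => i; rewrite !inE /=.
      case: (eqVneq (g i) j) => [->|]; last by rewrite !andbF.
      by move: jK; rewrite !inE => ->; rewrite !andbT.
    apply: hB; apply: fsubset_trans (fsubsetUr _ _).
    exact: bigfcup_sup.
  rewrite big_const_seq count_predT iter_addr_0 -[leLHS]mulr_natr /d mulrAC.
  by rewrite ler_pdivrMr// ler_wpM2l ?(ltW e30)// ler_nat.
rewrite -(subrKA (\sum_(i <- V) f i)).
have -> : e = e / 4 + e / 4 + (e / 4 + e / 4) by field.
apply: le_trans (ler_normD _ _) (lerD _ _) => //.
rewrite -(subrKA (\sum_(i <- A0) f i)).
apply: le_trans (ler_normD _ _) (lerD _ _); first exact: close.
by rewrite distrC; exact: close.
Qed.

(** For nonnegative terms no summability is needed beforehand: a finite sum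
splits along the fibers, and each part is at most the sum of its fiber. *)
Lemma bounded_sums_fibers I J (g : I -> J) (f : I -> C^o) (F : J -> C^o) :
  (forall i, 0 <= f i) ->
  (forall j, has_sum xpredT (fun i => if g i == j then f i else 0 : C^o) (F j)) ->
  bounded_sums F -> bounded_sums f.
Proof.
move=> f0 hF [M hM]; exists M => A.
under eq_bigr do rewrite ger0_norm//.
pose K := [fset g i | i in A]%fset.
rewrite (@sum_image_fiber _ _ g A K); last by move=> i iA; apply/imfsetP; exists i.
apply: le_trans (hM K); apply: ler_sum => j _.
apply/ler_addgt0Pr => e e0.
have /has_sumP/(_ e e0)[B hB] := hF j.
have := hB (A `|` B)%fset (fsubsetUr _ _).
set S := \sum_(i <- (A `|` B)%fset | _) _ => hS.
have AS : \sum_(i <- A | g i == j) f i <= S.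
  rewrite /S (@big_fset_split _ A) ?fsubsetUl// -big_mkcond /= lerDl.
  by apply: sumr_ge0 => i _; case: ifP.
apply: le_trans AS _.
have S0 : 0 <= S by apply: sumr_ge0 => i _; case: ifP.
rewrite -(ger0_norm S0) -lerBlDl; apply: le_trans (lerB_dist _ _) _.
by rewrite distrC.
Qed.

(** Tannery's theorem, that is, dominated convergence for sums.  Outside a
finite set A0 everything is negligible uniformly in n because the c n are
bounded by B; on A0 convergence is a finite matter. *)
Lemma has_sum_tannery I (t : I -> C^o) (c : nat -> I -> C^o) (l : I -> C^o)
    (S : nat -> C^o) (s : C^o) (B : C) :
  bounded_sums t -> (forall n i, `|c n i| <= B) ->
  (forall i, c n i @[n --> \oo] --> l i) ->
  (forall n, has_sum xpredT (fun i => c n i * t i : C^o) (S n)) ->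
  S @ \oo --> s ->
  has_sum xpredT (fun i => l i * t i : C^o) s.
Proof.
move=> bt cB cl cS Ss.
have B0 (i : I) : 0 <= B by rewrite (le_trans _ (cB 0%N i)).
have lB i : `|l i| <= B.
  apply/ler_addgt0Pr => e e0.
  have /cvgrPdist_le/(_ e e0)[n _ /(_ n (leqnn n)) hn] := cl i.
  rewrite -(subrK (c n i) (l i)) addrC.
  by apply: le_trans (ler_normD _ _) (lerD _ _).
apply/has_sumP => e e0.
have e8 : 0 < e / 8 by rewrite divr_gt0.
have B1 : 0 < `|B| + 1 by rewrite ltr_wpDl.
have [A0 hA0] := small_tails bt (divr_gt0 e8 B1).
have tail (b : I -> C) (A : {fset I}) : (forall i, `|b i| <= B) -> (A0 `<=` A)%fset ->
    `|\sum_(i <- A) b i * t i - \sum_(i <- A0) b i * t i| <= e / 8.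
  move=> bB AA; rewrite (big_fset_split _ AA) addrC addKr.
  apply: le_trans (ler_norm_sum _ _ _) _.
  have dA : [disjoint A `\` A0 & A0]%fset.
    by apply/fdisjointP => i; rewrite !inE => /andP[].
  have := hA0 _ dA.
  rewrite ler_pdivlMr// => /(le_trans _); apply.
  rewrite mulr_suml; apply: ler_sum => i _; rewrite normrM mulrC ler_wpM2l//.
  by rewrite (le_trans (bB i))// (ger0_norm (B0 i)) lerDl.
have lim0 : (\sum_(i <- A0) c n i * t i : C^o) @[n --> \oo] --> (\sum_(i <- A0) l i * t i : C^o).
  apply: cvg_big => [|i _]; first exact: add_continuous.
  exact: cvgMC (cl i) (cvg_cst _).
have [n [hn1 hn2]] : exists n, `|s - S n| <= e / 8 /\
    `|\sum_(i <- A0) l i * t i - \sum_(i <- A0) c n i * t i| <= e / 8.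
  have /cvgrPdist_le/(_ _ e8)[n1 _ h1] := Ss.
  have /cvgrPdist_le/(_ _ e8)[n2 _ h2] := lim0.
  by exists (maxn n1 n2); split; [apply: h1|apply: h2]; rewrite /= ?leq_maxl ?leq_maxr.
have /has_sumP/(_ _ e8)[D hD] := cS n.
exists A0 => A AA.
rewrite -(subrKA (S n)) -[S n - _](subrKA (\sum_(i <- (A0 `|` D)%fset) c n i * t i)).
rewrite -[X in _ + (_ + X)](subrKA (\sum_(i <- A0) c n i * t i)).
rewrite -[X in _ + (_ + (_ + X))](subrKA (\sum_(i <- A0) l i * t i)).
have -> : e = e / 8 + (e / 8 + (e / 8 + (e / 8 + e / 2))) by field.
apply: le_trans (ler_normD _ _) (lerD hn1 _).
apply: le_trans (ler_normD _ _) (lerD (hD _ (fsubsetUr _ _)) _).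
apply: le_trans (ler_normD _ _) (lerD (tail _ _ (cB n) (fsubsetUl _ _)) _).
apply: le_trans (ler_normD _ _) (lerD _ _); first by rewrite distrC.
rewrite distrC; apply: le_trans (tail _ _ lB AA) _.
by rewrite ler_wpM2l ?(ltW e0)// lef_pV2 ?posrE// ler_nat.
Qed.

Lemma bounded_sums_section I J (h : J -> I) (g : I -> J) (f : I -> C^o) :
  cancel h g -> (forall i, f i != 0 -> h (g i) = i) ->
  bounded_sums (f \o h) -> bounded_sums f.
Proof.
move=> hK fh bfh.
have nf : bounded_sums (fun i => `|f i| : C^o).
  apply: (bounded_sums_fibers (g := g) (F := fun j => `|f (h j)| : C^o)) => //.
    move=> j; pose F i : C^o := if g i == j then `|f i| else 0.
    have -> : `|f (h j)| = \sum_(i <- [:: h j]) F i by rewrite big_seq1 /F hK eqxx.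
    apply: has_sum_finite => // i; rewrite inE /F; case: (eqVneq (g i) j) => [<-|//].
    by have [->|/fh ->] := eqVneq (f i) 0; rewrite ?normr0 ?eqxx.
  by apply: le_bounded_sums bfh => j; rewrite normr_id.
by apply: le_bounded_sums nf => i; rewrite normr_id.
Qed.

(** Reindexing along an injection whose image contains the support; the
injection is given with a left inverse g, whose fibers meet the support in at
most one point. *)
Lemma has_sum_section I J (h : J -> I) (g : I -> J) (f : I -> C^o) (s : C^o) :
  cancel h g -> (forall i, f i != 0 -> h (g i) = i) ->
  bounded_sums (f \o h) ->
  has_sum xpredT (f \o h : J -> C^o) s -> has_sum xpredT f s.
Proof.
move=> hK fh bfh; apply: (has_sum_fibers (g := g)); first exact: bounded_sums_section bfh.
move=> j; pose F i : C^o := if g i == j then f i else 0.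
have -> : (f \o h) j = \sum_(i <- [:: h j]) F i by rewrite big_seq1 /F hK eqxx.
apply: has_sum_finite => // i; rewrite inE /F; case: (eqVneq (g i) j) => [<-|//].
by have [->|/fh ->] := eqVneq (f i) 0; rewrite ?eqxx.
Qed.

End UnorderedSums.

(** * The products (b; q)_n and their limits *)

Section QPochhammer.
Variable R : realType.
Local Notation C := R[i].

Lemma normC_real (z : C) : exists2 r : R, `|z| = r%:C & 0 <= r.
Proof.
by exists (Num.sqrt ((complex.Re z) ^+ 2 + (complex.Im z) ^+ 2)); rewrite ?normc_def ?sqrtr_ge0.
Qed.

Lemma normC_le_ReIm (z : C) : `|z| <= (`|complex.Re z| + `|complex.Im z|)%:C.
Proof.
rewrite normc_def lecR -[leRHS]ger0_norm ?addr_ge0// -sqrtr_sqr.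
apply: ler_wsqrtr; rewrite sqrrD !real_normK ?num_real// lerD2r lerDl.
by rewrite mulrn_wge0// mulr_ge0.
Qed.

Lemma Re_le_normC (z : C) (r : R) : `|z| <= r%:C -> `|complex.Re z| <= r.
Proof. by rewrite -lecR; apply: le_trans; exact: normc_ge_Re. Qed.

Lemma Im_le_normC (z : C) (r : R) : `|z| <= r%:C -> `|complex.Im z| <= r.
Proof.
move=> h; rewrite -normrN -ReiNIm; apply: Re_le_normC.
by rewrite normrM complexiE normCi mulr1.
Qed.

Lemma cvg_complex (u : nat -> C^o) (x y : R) :
  (complex.Re (u n) : R) @[n --> \oo] --> x ->
  (complex.Im (u n) : R) @[n --> \oo] --> y -> u @ \oo --> (x +i* y : C^o).
Proof.
move=> /cvgrPdist_le hx /cvgrPdist_le hy; apply/cvgrPdist_le => e e0.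
have [e' ee'] : exists e' : R, e = e'%:C.
  by exists (complex.Re e); rewrite RRe_real// ger0_real// ltW.
have e'0 : 0 < e' / 2 by move: e0; rewrite ee' ltcR => ?; rewrite divr_gt0.
have [n1 _ h1] := hx _ e'0; have [n2 _ h2] := hy _ e'0.
exists (maxn n1 n2) => // n; rewrite /= geq_max => /andP[/h1 /= H1 /h2 /= H2].
apply: le_trans (normC_le_ReIm _) _; rewrite ee' lecR (splitr e').
by move: H1 H2; case: (u n) => a b /= H1 H2; rewrite lerD.
Qed.

(** Geometrically bounded increments make the telescoping series absolutely
convergent; this is used for the real and imaginary parts of the partial
products. *)
Lemma cvg_geometric_increments (u : nat -> R) (B r : R) :
  0 <= r < 1 -> (forall n, `|u n.+1 - u n| <= B * r ^+ n) -> cvgn u.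
Proof.
move=> /andP[r0 r1] hu.
have B0 : 0 <= B by have := hu 0%N; rewrite expr0 mulr1; apply: le_trans.
have -> : u = (fun n => u 0%N + series (telescope u) n).
  by apply/funext => n; rewrite -eq_sum_telescope.
apply: is_cvgD; first exact: is_cvg_cst.
apply: normed_cvg; apply: (@series_le_cvg _ _ (geometric B r)) => //.
- by move=> n; exact: normr_ge0.
- by move=> n; apply: mulr_ge0; rewrite ?exprn_ge0.
by apply: is_cvg_geometric_series; rewrite ger0_norm.
Qed.

Lemma sum_geom_le (r : R) n : 0 <= r < 1 -> \sum_(j < n) r ^+ j <= (1 - r)^-1.
Proof.
move=> /andP[r0 r1]; have r10 : 0 < 1 - r by rewrite subr_gt0.
rewrite -[leRHS]mul1r ler_pdivlMr// mulrC -opprB mulNr -subrX1 opprB.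
by rewrite lerBlDr lerDl exprn_ge0.
Qed.

Lemma prod_geom_le (s r : R) n : 0 <= s -> 0 <= r < 1 ->
  \prod_(j < n) (1 + s * r ^+ j) <= expR (s / (1 - r)).
Proof.
move=> s0 /[dup] r01 /andP[r0 r1].
apply: (@le_trans _ _ (expR (s * \sum_(j < n) r ^+ j))); last first.
  by rewrite ler_expR ler_wpM2l// sum_geom_le.
rewrite mulr_sumr; elim: n => [|n IH]; first by rewrite !big_ord0 expR0.
have srn : 0 <= s * r ^+ n by rewrite mulr_ge0 ?exprn_ge0.
rewrite !big_ord_recr /= expRD ler_pM ?expR_ge1Dx ?addr_ge0//.
by apply: prodr_ge0 => j _; rewrite addr_ge0// mulr_ge0 ?exprn_ge0.
Qed.

Lemma qpochS (b q : C) n : qpoch b q n.+1 = qpoch b q n * (1 - b * q ^+ n).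
Proof. by rewrite /qpoch big_ord_recr. Qed.

Lemma qpoch0 (b q : C) : qpoch b q 0 = 1.
Proof. by rewrite /qpoch big_ord0. Qed.

Lemma qpochs_inf3 (b1 b2 b3 q : C) :
  qpochs_inf [:: b1; b2; b3] q = qpoch_inf b1 q * qpoch_inf b2 q * qpoch_inf b3 q.
Proof. by rewrite /qpochs_inf !big_cons big_nil mulr1 mulrA. Qed.

Lemma qpoch_bounded (b q : C) : `|q| < 1 -> exists M : R, forall n, `|qpoch b q n| <= M%:C.
Proof.
have [r qr r0] := normC_real q; have [s bs s0] := normC_real b.
rewrite qr -(rmorph1 (real_complex R)) ltcR => r1.
exists (expR (s / (1 - r))) => n.
rewrite /qpoch normr_prod.
apply: (@le_trans _ _ (\prod_(j < n) (1 + s * r ^+ j)%:C)).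
  apply: ler_prod => j _; rewrite normr_ge0 /=.
  apply: le_trans (ler_normB _ _) _.
  by rewrite normr1 normrM normrX qr bs rmorphD rmorph1 rmorphM rmorphXn.
by rewrite -(rmorph_prod (real_complex R)) lecR prod_geom_le// r0.
Qed.

Lemma cvg_qpoch (b q : C) : `|q| < 1 ->
  (qpoch b q : nat -> C^o) @ \oo --> (qpoch_inf b q : C^o).
Proof.
move=> q1; have [M hM] := qpoch_bounded b q1.
have [r qr r0] := normC_real q; have [s bs s0] := normC_real b.
have r1 : r < 1 by move: q1; rewrite qr -(rmorph1 (real_complex R)) ltcR.
have dq n : `|qpoch b q n.+1 - qpoch b q n| <= (M * s * r ^+ n)%:C.
  rewrite qpochS mulrBr mulr1 addrC addKr normrN !normrM bs normrX qr.
  by rewrite !rmorphM rmorphXn /= -!mulrA ler_wpM2r// mulr_ge0 ?exprn_ge0 ?ler0c.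
have r01 : 0 <= r < 1 by rewrite r0.
have /cvg_ex[x hx] : cvgn (fun n => complex.Re (qpoch b q n) : R).
  apply: (cvg_geometric_increments r01) => n; rewrite -raddfB.
  exact: Re_le_normC (dq n).
have /cvg_ex[y hy] : cvgn (fun n => complex.Im (qpoch b q n) : R).
  apply: (cvg_geometric_increments r01) => n; rewrite -raddfB.
  exact: Im_le_normC (dq n).
have h := cvg_complex hx hy.
by rewrite /qpoch_inf (norm_cvg_lim h).
Qed.

Lemma qpoch_neq0 (q : C) n : `|q| < 1 -> qpoch q q n != 0.
Proof.
move=> q1; apply/prodf_neq0 => j _; rewrite -exprS subr_eq0 eq_sym.
apply/eqP => qj1; have : `|q ^+ j.+1| < 1 by rewrite normrX exprn_ilt1.
by rewrite qj1 normr1 ltxx.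
Qed.

(** With r = |q| < 1, one has 1 / (1 - r^(j+1)) <= 1 + r^j / (1 - r), so
inverting the product costs no more than a product of the kind bounded by
[prod_geom_le]. *)
Lemma inv_qpoch_bounded (q : C) : `|q| < 1 ->
  exists M : R, forall n, `|(qpoch q q n)^-1| <= M%:C.
Proof.
have [r qr r0] := normC_real q.
rewrite qr -(rmorph1 (real_complex R)) ltcR => r1.
have r10 : 0 < 1 - r by rewrite subr_gt0.
exists (expR ((1 - r)^-1 / (1 - r))) => n.
rewrite /qpoch -prodfV normr_prod.
apply: (@le_trans _ _ (\prod_(j < n) (1 + (1 - r)^-1 * r ^+ j)%:C)).
  apply: ler_prod => j _; rewrite normr_ge0 /=.
  rewrite -exprS normfV.
  have rj : r ^+ j.+1 <= r by rewrite exprS ler_piMr// exprn_ile1// ltW.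
  have rj1 : 0 < 1 - r ^+ j.+1 by rewrite subr_gt0 (le_lt_trans rj).
  apply: (@le_trans _ _ ((1 - r ^+ j.+1)^-1)%:C).
    have le1 : (1 - r ^+ j.+1)%:C <= `|1 - q ^+ j.+1|.
      rewrite rmorphB rmorph1 rmorphXn /= -qr -normrX -[X in X - _](@normr1 C).
      exact: lerB_dist.
    have lt0 : 0 < (1 - r ^+ j.+1)%:C by rewrite ltcR.
    by rewrite fmorphV lef_pV2 ?posrE// (lt_le_trans lt0).
  rewrite lecR -[leLHS]mul1r ler_pdivrMr// mulrDl mul1r -lerBlDl subKr.
  rewrite mulrAC exprS ler_wpM2r ?exprn_ge0// (le_trans (ltW r1))//.
  by rewrite ler_pdivlMl// mulr1 lerD2l lerN2 -exprS.
by rewrite -(rmorph_prod (real_complex R)) lecR prod_geom_le ?r0// invr_ge0 ltW.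
Qed.

(** The finite products stay away from zero, since their inverses are bounded. *)
Lemma qpoch_inf_neq0 (q : C) : `|q| < 1 -> qpoch_inf q q != 0.
Proof.
move=> q1; have [M hM] := inv_qpoch_bounded q1.
apply/eqP => q0; have := @cvg_qpoch q q q1; rewrite q0 => /cvgrPdist_lt.
have M0 : 0 < M%:C :> C.
  by apply: lt_le_trans (hM 0%N); rewrite normr_gt0 invr_eq0 qpoch_neq0.
move=> /(_ (M%:C^-1)); rewrite invr_gt0 => /(_ M0)[n _ /(_ n (leqnn n))] /=.
rewrite sub0r normrN => /lt_le_trans h.
have := hM n; rewrite normfV -[X in _ <= X]invrK.
rewrite lef_pV2 ?posrE ?invr_gt0 ?normr_gt0 ?qpoch_neq0// => /h.
by rewrite ltxx.
Qed.

End QPochhammer.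

(** * The q-Vandermonde sum and the Durfee rectangle identity *)

Section Durfee.
Variable R : realType.
Local Notation C := R[i].

Lemma bounded_sums_geometric (f : nat -> C) (M r : R) :
  0 <= r < 1 -> (forall n, `|f n| <= (M * r ^+ n)%:C) -> bounded_sums f.
Proof.
move=> r01 fM.
have M0 : 0 <= M by have := fM 0%N; rewrite expr0 mulr1 -ler0c; apply: le_trans.
apply: (@bounded_sums_seq _ _ _ (fun n => iota 0 n) (M / (1 - r))%:C) => [n|A|n].
- exact: iota_uniq.
- exists (\max_(i <- A) i)%N.+1 => i iA.
  rewrite mem_iota add0n ltnS /=.
  by have := @leq_bigmax_seq _ (enum_fset A) xpredT id i iA isT.
- apply: (@le_trans _ _ (\sum_(i <- iota 0 n) (M * r ^+ i)%:C)).
    by apply: ler_sum => i _; exact: fM.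
  rewrite -rmorph_sum lecR -mulr_sumr ler_wpM2l// -{1}(subn0 n).
  by rewrite -/(index_iota 0 n) big_mkord sum_geom_le.
Qed.

Lemma qfactor_neq0 (q : C) n : `|q| < 1 -> 1 - q * q ^+ n != 0.
Proof.
move=> q1; apply: contraNneq (qpoch_neq0 n.+1 q1) => h.
by rewrite qpochS h mulr0.
Qed.

(** Let S(U, V) be the left-hand side.  Then (1 - q^(U+1)) S(U+1, V) = S(U, V):
split 1 - q^(U+1) as (1 - q^(U+1-r)) + q^(U+1-r) (1 - q^r), cancel each part
against the matching factor of the denominator, and combine the first part at r
with the second part at r+1. *)
Lemma qvandermonde (q : C) (U V : nat) : `|q| < 1 ->
  \sum_(r < U.+1) (if (r <= V)%N then
     q ^+ ((U - r) * (V - r)) /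
     (qpoch q q r * qpoch q q (U - r) * qpoch q q (V - r)) else 0)
  = (qpoch q q U * qpoch q q V)^-1.
Proof.
move=> q1; have Q0 n : qpoch q q n != 0 by exact: qpoch_neq0.
elim: U => [|U IH].
by rewrite big_ord1 /= !subn0 mul0n qpoch0 expr0 !mul1r.
have U0 : 1 - q * q ^+ U != 0 by exact: qfactor_neq0.
pose T r := if (r <= V)%N then q ^+ ((U.+1 - r) * (V - r)) /
     (qpoch q q r * qpoch q q (U.+1 - r) * qpoch q q (V - r)) else 0.
apply: (mulfI U0).
rewrite -[LHS]/(_ * \sum_(r < U.+2) T r) mulr_sumr.
transitivity (\sum_(r < U.+2) ((1 - q ^+ (U.+1 - r)) * T r) +
              \sum_(r < U.+2) (q ^+ (U.+1 - r) * (1 - q ^+ r) * T r)).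
  rewrite -big_split /=; apply: eq_bigr => r _; rewrite -mulrDl; congr (_ * _).
  have -> : q * q ^+ U = q ^+ (U.+1 - r) * q ^+ r.
    by rewrite -exprD subnK ?exprS// -ltnS.
  ring.
rewrite big_ord_recr [X in _ + X]big_ord_recl /= subnn expr0 subrr mulr0 !mul0r.
rewrite addr0 add0r -big_split /=.
transitivity ((qpoch q q U * qpoch q q V)^-1); last first.
  by rewrite qpochS; field; rewrite U0 !Q0.
rewrite -IH; apply: eq_bigr => r _; rewrite /bump add1n /T.
have rU : (r <= U)%N by rewrite -ltnS.
rewrite subSS subSn//; set d := (U - r)%N.
have d0 : 1 - q * q ^+ d != 0 by exact: qfactor_neq0.
have r0 : 1 - q * q ^+ r != 0 by exact: qfactor_neq0.
have [rV|rV|rV] := ltngtP r V.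
- have [e eV] : exists e, (V - r)%N = e.+1 by exists (V - r).-1; rewrite prednK// subn_gt0.
  have -> : (V - r.+1)%N = e by rewrite subnS eV.
  have e0 : 1 - q * q ^+ e != 0 by exact: qfactor_neq0.
  rewrite eV !qpochS mulSn mulnS !exprD !exprS.
  by field; rewrite d0 r0 e0 !Q0.
- by rewrite !mulr0 addr0.
- rewrite -rV subnn !muln0 !expr0 mulr0 addr0 !qpochS exprS.
  by field; rewrite d0 !Q0.
Qed.

Definition durfee_term (q : C) (m s : nat) : C^o :=
  q ^+ (s * (s + m)) / (qpoch q q s * qpoch q q (s + m)).

Lemma bounded_durfee_term (q : C) (m : nat) : `|q| < 1 ->
  bounded_sums (durfee_term q m).
Proof.
move=> q1; have [M hM] := inv_qpoch_bounded q1.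
have [r qr r0] := normC_real q.
have r1 : r < 1 by move: q1; rewrite qr -(rmorph1 (real_complex R)) ltcR.
apply: (@bounded_sums_geometric _ (M * M) r) => [|s]; first by rewrite r0.
have qs : `|q ^+ (s * (s + m))| <= (r ^+ s)%:C.
  rewrite normrX qr -rmorphXn lecR ler_wiXn2l ?(ltW r1)//.
  by case: s => // s; rewrite leq_pmulr// addSn.
rewrite /durfee_term invfM !normrM mulrC !rmorphM /=.
by rewrite ler_pM ?mulr_ge0// ler_pM.
Qed.

(** Take U = n and V = n + m in [qvandermonde] and put s = n - r: the factor
1 / (q)_{n-s} tends to 1 / (q)_oo for fixed s, and the right-hand side tends to
1 / (q)_oo^2. *)
Lemma has_sum_durfee (q : C) (m : nat) : `|q| < 1 ->
  has_sum xpredT (durfee_term q m) ((qpoch_inf q q)^-1 : C^o).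
Proof.
move=> q1; have Q0 n : qpoch q q n != 0 by exact: qpoch_neq0.
have Qi0 := qpoch_inf_neq0 q1.
have [M hM] := inv_qpoch_bounded q1.
have cQ : ((qpoch q q n)^-1 : C^o) @[n --> \oo] --> ((qpoch_inf q q)^-1 : C^o).
  by apply: cvgVC => //; exact: cvg_qpoch.
have bt := bounded_durfee_term m q1.
have h := @has_sum_tannery R nat (durfee_term q m)
  (fun n s => if (s <= n)%N then (qpoch q q (n - s))^-1 else 0)
  (fun=> (qpoch_inf q q)^-1) (fun n => (qpoch q q n * qpoch q q (n + m))^-1)
  ((qpoch_inf q q)^-1 * (qpoch_inf q q)^-1) (M%:C) bt.
apply: (eq_has_sum _ _ (has_sumZ (c := qpoch_inf q q) (h _ _ _ _))).
- by move=> s; rewrite mulrA divff// mul1r.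
- by rewrite mulrA divff// mul1r.
- by move=> n i; case: ifP => // _; rewrite normr0 (le_trans _ (hM 0%N)).
- move=> s; rewrite -(cvg_shiftn s).
  by apply: cvg_trans cQ; apply: near_eq_cvg; apply: nearW => n; rewrite /= leq_addl addnK.
- move=> n.
  pose F s : C^o := (if (s <= n)%N then (qpoch q q (n - s))^-1 else 0) * durfee_term q m s.
  have -> : (qpoch q q n * qpoch q q (n + m))^-1 = \sum_(s <- iota 0 n.+1) F s.
    rewrite -qvandermonde// -[iota _ _]/(index_iota 0 n.+1) big_mkord.
    rewrite [RHS](reindex_inj rev_ord_inj) /=; apply: eq_bigr => s _.
    have sn : (s <= n)%N by rewrite -ltnS.
    rewrite (leq_trans sn) ?leq_addr// /F subSS leq_subr subKn// /durfee_term.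
    by rewrite addnBAC//; field; rewrite !Q0.
  apply: has_sum_finite; first exact: iota_uniq.
  by move=> s; rewrite mem_iota /= add0n ltnS /F => /negbTE ->; rewrite mul0r.
- under eq_fun do rewrite invfM.
  apply: cvgMC => //.
  by rewrite (cvg_shiftn m (fun n => (qpoch q q n)^-1 : C^o)).
Qed.

End Durfee.

(** * The Jacobi triple product *)

Section JacobiTripleProduct.
Variable R : realType.
Local Notation C := R[i].

Definition gauss_binom (q : C) (n i : nat) : C :=
  qpoch q q n / (qpoch q q i * qpoch q q (n - i)).

(** The inductive step of the q-binomial theorem, for any sequence u on which
multiplication by y acts as the shift twisted by q^(N-i); it rests on the Pascal
rule G(N+1, i) = G(N, i) + q^(N+1-i) G(N, i-1). *)
Lemma sum_gauss_binomS (q y : C) (u : nat -> C) (N : nat) : `|q| < 1 ->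
  (forall i, (i <= N)%N -> u i.+1 * q ^+ (N - i) = u i * y) ->
  \sum_(i < N.+2) gauss_binom q N.+1 i * u i =
  (1 + y) * \sum_(i < N.+1) gauss_binom q N i * u i.
Proof.
move=> q1 uy; have Q0 n : qpoch q q n != 0 by exact: qpoch_neq0.
have N0 := qfactor_neq0 N q1.
(* The two terms of the Pascal rule, written as multiples of the coefficient
   so that no boundary case arises: A vanishes at i = N+1 and B at i = 0. *)
pose A i := (1 - q ^+ (N.+1 - i)) / (1 - q * q ^+ N) * gauss_binom q N.+1 i.
pose B i := q ^+ (N.+1 - i) * (1 - q ^+ i) / (1 - q * q ^+ N) * gauss_binom q N.+1 i.
transitivity (\sum_(i < N.+2) A i * u i + \sum_(i < N.+2) B i * u i).
  rewrite -big_split /=; apply: eq_bigr => i _; rewrite -mulrDl; congr (_ * _).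
  have iN : (i <= N.+1)%N by rewrite -ltnS.
  rewrite /A /B -mulrDl -[LHS]mul1r; congr (_ * _).
  have qN : q * q ^+ N = q ^+ (N.+1 - i) * q ^+ i by rewrite -exprD subnK ?exprS.
  rewrite -mulrDl; apply/esym; rewrite -[RHS](divff N0); congr (_ / _).
  by rewrite qN; ring.
rewrite big_ord_recr [X in _ + X]big_ord_recl /=.
rewrite {2}/A subnn expr0 subrr !mul0r addr0.
rewrite {1}/B expr0 subrr mulr0 !mul0r add0r.
rewrite mulrDl mul1r mulr_sumr; congr (_ + _); apply: eq_bigr => i _.
  have iN : (i <= N)%N by rewrite -ltnS.
  rewrite /A /gauss_binom subSn// !qpochS exprS.
  have i0 := qfactor_neq0 (N - i) q1.
  by congr (_ * _); field; rewrite N0 i0 !Q0.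
have iN : (i <= N)%N by rewrite -ltnS.
rewrite /bump add1n mulrCA [y * _]mulrC -uy// /B /gauss_binom subSS !qpochS exprS.
have i0 := qfactor_neq0 i q1.
by field; rewrite N0 i0 !Q0.
Qed.

Definition theta_term (z p : C) (m : int) : C^o := z ^ m * p ^+ (`|m| ^ 2)%N.

(** The expected expansion of
prod_{j<a} (1 + z p^(2j+1)) prod_{j<b} (1 + p^(2j+1) / z); keeping the numbers
of factors a and b independent allows an induction adding one factor at a time. *)
Definition finite_theta (z p : C) (a b : nat) :=
  \sum_(i < (a + b).+1) gauss_binom (p ^+ 2) (a + b) i * theta_term z p (i%:Z - b%:Z).

Lemma abs_sqr (m : int) : (`|m| ^ 2)%N%:Z = m * m.
Proof. by rewrite PoszM abszE -normrM ger0_norm// -expr2 sqr_ge0. Qed.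

(** Exchanging the two products amounts to inverting z; it turns the step that
adds a factor to the first product into the one for the second. *)
Lemma finite_theta_sym (z p : C) (a b : nat) :
  finite_theta z p a b = finite_theta z^-1 p b a.
Proof.
rewrite /finite_theta (addnC b a) (reindex_inj rev_ord_inj) /=.
apply: eq_bigr => i _.
have iN : (i <= a + b)%N by rewrite -ltnS.
rewrite subSS /gauss_binom subKn// [qpoch _ _ (a + b - i) * _]mulrC; congr (_ * _).
have -> : ((a + b - i)%N%:Z - b%:Z) = - (i%:Z - a%:Z) by lia.
by rewrite /theta_term abszN exprz_inv.
Qed.

Lemma finite_thetaS (z p : C) (a b : nat) : `|p| < 1 -> z != 0 ->
  finite_theta z p a.+1 b = (1 + z * p ^+ (2 * a).+1) * finite_theta z p a b.
Proof.
move=> p1 z0; rewrite /finite_theta addSn.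
have p21 : `|p ^+ 2| < 1 by rewrite normrX exprn_ilt1.
apply: (sum_gauss_binomS (u := fun i => theta_term z p (i%:Z - b%:Z))) => // i iN.
rewrite /theta_term.
have -> : (i.+1%:Z - b%:Z) = (i%:Z - b%:Z) + 1 by lia.
rewrite expfzDr// expr1z; set m := i%:Z - b%:Z.
have key : p ^+ (`|(m + 1)%R| ^ 2)%N * (p ^+ 2) ^+ (a + b - i) =
    p ^+ (`|m| ^ 2)%N * p ^+ (2 * a).+1.
  rewrite -exprM -!exprD; congr (_ ^+ _); apply/eqP; rewrite -eqz_nat; apply/eqP.
  have -> : ((2 * a).+1 = 2 * a + 1)%N by rewrite addn1.
  by rewrite !PoszD !abs_sqr -subzn// PoszD /m; ring.
transitivity (z ^ m * z * (p ^+ (`|(m + 1)%R| ^ 2)%N * (p ^+ 2) ^+ (a + b - i))).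
  by ring.
by rewrite key; ring.
Qed.

Lemma finite_jacobi (z p : C) (a b : nat) : `|p| < 1 -> z != 0 ->
  (\prod_(j < a) (1 + z * p ^+ (2 * j).+1)) *
  (\prod_(j < b) (1 + z^-1 * p ^+ (2 * j).+1)) = finite_theta z p a b.
Proof.
move=> p1 z0; elim: b => [|b IH].
  rewrite big_ord0 mulr1; elim: a => [|a IH].
    rewrite big_ord0 /finite_theta big_ord1 /theta_term /gauss_binom /=.
    rewrite subrr expr0z !mul1r !qpoch0 mulr1 invr1 !mul1r.
    by rewrite [X in p ^+ X](_ : _ = 0%N) ?expr0.
  by rewrite big_ord_recr /= finite_thetaS// -IH mulrC.
rewrite finite_theta_sym finite_thetaS ?invr_eq0// -finite_theta_sym -IH.
by rewrite big_ord_recr /=; ring.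
Qed.

(** The coefficient of z^m p^(m^2) in the product with n factors of each kind.  Its
numerator and denominator converge, for fixed m, to (q)_oo and (q)_oo^2. *)
Definition theta_coef (q : C) (n : nat) (m : int) : C^o :=
  if (absz m <= n)%N then
    qpoch q q n.*2 / (qpoch q q (n + absz m) * qpoch q q (n - absz m)) else 0.

Definition int_range (n : nat) : seq int := [seq i%:Z - n%:Z | i <- iota 0 n.*2.+1].

Lemma mem_int_range n (m : int) : (m \in int_range n) = (absz m <= n)%N.
Proof.
apply/mapP/idP => [[i + ->]|mn]; first by rewrite mem_iota; lia.
by exists (absz (m + n%:Z)); rewrite ?mem_iota; lia.
Qed.

Lemma int_range_uniq n : uniq (int_range n).
Proof. by rewrite map_inj_uniq ?iota_uniq// => i j; lia. Qed.

Lemma sum_theta_coef (z p : C) (n : nat) : `|p| < 1 -> z != 0 ->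
  \sum_(m <- int_range n) theta_coef (p ^+ 2) n m * theta_term z p m =
  qpoch (- (z * p)) (p ^+ 2) n * qpoch (- (z^-1 * p)) (p ^+ 2) n.
Proof.
move=> p1 z0.
have prodE (y : C) : qpoch (- (y * p)) (p ^+ 2) n =
    \prod_(j < n) (1 + y * p ^+ (2 * j).+1).
  apply: eq_bigr => j _; rewrite mulNr opprK -mulrA.
  by rewrite -exprM -exprS.
rewrite !prodE finite_jacobi// /finite_theta addnn big_map.
rewrite -[iota _ _]/(index_iota 0 n.*2.+1) big_mkord; apply: eq_bigr => i _.
congr (_ * _); rewrite /theta_coef /gauss_binom.
have i2n : (i <= n.*2)%N by rewrite -ltnS.
rewrite ifT; last by lia.
have [ni|ni] := leqP n i.
  by congr (_ / (qpoch _ _ _ * qpoch _ _ _)); lia.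
by rewrite [X in _ / X = _]mulrC; congr (_ / (qpoch _ _ _ * qpoch _ _ _)); lia.
Qed.

Lemma int_range_cover (A : {fset int}) : exists n, forall m, m \in A -> m \in int_range n.
Proof.
exists (\max_(m <- A) absz m)%N => m mA; rewrite mem_int_range.
by have := @leq_bigmax_seq _ (enum_fset A) xpredT absz m mA isT.
Qed.

Lemma normrXz (z : C) (m : int) : `|z ^ m| = `|z| ^ m.
Proof. by case: m => n; rewrite /exprz ?normfV normrX. Qed.

(** Replace z and p by their moduli w and t.  The finite triple product is then
bounded in n, its coefficients are at least (t^2; t^2)_{2n}, which is bounded
below, and its terms are nonnegative, so the partial sums over [-n, n] are
bounded. *)
Lemma bounded_theta_term (z p : C) : `|p| < 1 -> z != 0 ->
  bounded_sums (theta_term z p).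
Proof.
move=> p1 z0; set w := `|z|; set t := `|p|.
have w0 : w != 0 by rewrite normr_eq0.
have t0 : 0 <= t by exact: normr_ge0.
have t21 : t ^+ 2 < 1 by rewrite exprn_ilt1.
have nt1 : `|t| < 1 by rewrite ger0_norm.
have nt21 : `|t ^+ 2| < 1 by rewrite ger0_norm// exprn_ge0.
have fac j : 0 < 1 - t ^+ 2 * (t ^+ 2) ^+ j <= 1.
  rewrite -exprS subr_gt0 exprn_ilt1 ?exprn_ge0//= lerBlDr lerDl.
  by rewrite !exprn_ge0.
have Q0 n : 0 < qpoch (t ^+ 2) (t ^+ 2) n.
  by apply: prodr_gt0 => j _; have /andP[] := fac j.
have Q1 n : qpoch (t ^+ 2) (t ^+ 2) n <= 1.
  by apply: prodr_ile1 => j _; have /andP[/ltW -> ->] := fac j.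
have [M hM] := inv_qpoch_bounded nt21.
have [M1 hM1] := qpoch_bounded (- (w * t)) nt21.
have [M2 hM2] := qpoch_bounded (- (w^-1 * t)) nt21.
apply: (@bounded_sums_seq _ _ _ int_range (M%:C * (M1%:C * M2%:C))) => [n|A|n].
- exact: int_range_uniq.
- exact: int_range_cover.
rewrite [leLHS](_ : _ = \sum_(m <- int_range n) theta_term w t m); last first.
  by apply: eq_bigr => m _; rewrite normrM normrX normrXz.
have M0 : 0 < M%:C :> C.
  by apply: lt_le_trans (hM 0%N); rewrite normr_gt0 invr_eq0 lt0r_neq0.
rewrite -ler_pdivrMl//.
have term0 m : 0 <= theta_term w t m.
  by rewrite mulr_ge0 ?exprn_ge0// exprz_ge0// normr_ge0.
apply: (@le_trans _ _ (\sum_(m <- int_range n) theta_coef (t ^+ 2) n m * theta_term w t m)).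
  rewrite mulr_sumr big_seq [leRHS]big_seq; apply: ler_sum => m.
  rewrite mem_int_range => mn; rewrite ler_wpM2r// /theta_coef mn.
  apply: (@le_trans _ _ (qpoch (t ^+ 2) (t ^+ 2) n.*2)).
    rewrite -[leRHS]invrK lef_pV2 ?posrE ?invr_gt0//.
    by have := hM n.*2; rewrite gtr0_norm// invr_gt0.
  rewrite ler_peMr ?(ltW (Q0 _))// invf_ge1 ?mulr_gt0//.
  by rewrite mulr_ile1 ?(ltW (Q0 _)).
have sum0 : 0 <= \sum_(m <- int_range n) theta_coef (t ^+ 2) n m * theta_term w t m.
  apply: sumr_ge0 => m _; rewrite mulr_ge0// /theta_coef; case: ifP => // _.
  by rewrite divr_ge0 ?mulr_ge0// ltW.
by rewrite -(ger0_norm sum0) sum_theta_coef// normrM ler_pM.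
Qed.

Lemma has_sum_jacobi (z p : C) : `|p| < 1 -> z != 0 ->
  has_sum xpredT (theta_term z p)
    (qpoch_inf (- (z * p)) (p ^+ 2) * qpoch_inf (- (z^-1 * p)) (p ^+ 2)
     * qpoch_inf (p ^+ 2) (p ^+ 2) : C^o).
Proof.
move=> p1 z0; set q := p ^+ 2.
have q1 : `|q| < 1 by rewrite normrX exprn_ilt1.
have Q0 n : qpoch q q n != 0 by exact: qpoch_neq0.
have Qi0 := qpoch_inf_neq0 q1.
have [M hM] := inv_qpoch_bounded q1.
have [M1 hM1] := qpoch_bounded q q1.
have h := @has_sum_tannery R int (theta_term z p) (theta_coef q)
  (fun=> (qpoch_inf q q)^-1)
  (fun n => qpoch (- (z * p)) q n * qpoch (- (z^-1 * p)) q n)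
  (qpoch_inf (- (z * p)) q * qpoch_inf (- (z^-1 * p)) q)
  (M1%:C * (M%:C * M%:C)) (bounded_theta_term p1 z0).
apply: (eq_has_sum _ _ (has_sumZ (c := qpoch_inf q q) (h _ _ _ _))).
- by move=> m; rewrite mulrA divff// mul1r.
- by rewrite mulrC.
- have M0 : 0 <= M%:C :> C by apply: le_trans (hM 0%N).
  have M10 : 0 <= M1%:C :> C by apply: le_trans (hM1 0%N).
  move=> n m; rewrite /theta_coef; case: ifP => _; last by rewrite normr0 !mulr_ge0.
  by rewrite invfM !normrM !ler_pM ?mulr_ge0.
(* Shifting n by |m| makes the condition |m| <= n hold for every n. *)
- move=> m; rewrite -(cvg_shiftn (absz m)).
  pose k := absz m.
  have -> : (qpoch_inf q q)^-1 = qpoch_inf q q * ((qpoch_inf q q)^-1 * (qpoch_inf q q)^-1).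
    by rewrite mulrA divff// mul1r.
  have -> : [sequence theta_coef q (n + absz m) m]_n = (fun n => qpoch q q (n + k).*2 *
      ((qpoch q q (n + k + k))^-1 * (qpoch q q n)^-1)).
    by apply/funext => n; rewrite /theta_coef /= leq_addl addnK invfM.
  have cQ := @cvg_qpoch R q q q1.
  have cV := cvgVC Qi0 cQ.
  have le2k n : (n <= (n + k).*2)%N by lia.
  have lekk n : (n <= n + k + k)%N by lia.
  exact: cvgMC (cvg_ge_subseq le2k cQ) (cvgMC (cvg_ge_subseq lekk cV) cV).
- move=> n; rewrite -sum_theta_coef//; apply: has_sum_finite; first exact: int_range_uniq.
  by move=> m; rewrite mem_int_range /theta_coef => /negbTE ->; rewrite mul0r.
- by apply: cvgMC; exact: cvg_qpoch.
Qed.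

End JacobiTripleProduct.

(** * Collapsing the multiple sum *)

Section NahmSum.
Variable R : realType.
Local Notation C := R[i].

(** The list l is n_{k-2}, ..., n_1: the coordinate to be summed first is at the
head.  In the recursive call u and v have become u + r and v + r, the variables
that remain fixed when r is summed out. *)
Fixpoint durfee_weight (q : C) (l : seq nat) (u v : nat) : C :=
  if l is r :: l' then
    q ^+ (u * v) / qpoch q q r * durfee_weight q l' (u + r) (v + r)
  else q ^+ (u * v).

(** Reading the tuple backwards exposes first v = n_k, then u = n_{k-1}, then the
list n_{k-2}, ..., n_1. *)
Definition nahm_term (q : C) (w : int -> C) (d : nat) (n : d.+2.-tuple nat) : C^o :=
  let s := rev n in let u := nth 0 s 1 in let v := nth 0 s 0 in
  w (u%:Z - v%:Z) * (durfee_weight q (drop 2 s) u v / (qpoch q q u * qpoch q q v)).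

Lemma nahm_termE (q : C) (w : int -> C) (d : nat) (n : d.+2.-tuple nat) u v l :
  rev n = v :: u :: l ->
  nahm_term q w n =
  w (u%:Z - v%:Z) * (durfee_weight q l u v / (qpoch q q u * qpoch q q v)).
Proof. by rewrite /nahm_term => -> /=; rewrite drop0. Qed.

(** For two coordinates, the pairs with u - v = m are parametrized by their
minimum s, and the term at s is w(m) times the Durfee rectangle term for |m|. *)
Lemma has_sum_nahm_fiber0 (q : C) (w : int -> C) (m : int) : `|q| < 1 ->
  has_sum xpredT (fun n : 2.-tuple nat =>
      if (nth 0%N (rev n) 1)%:Z - (nth 0%N (rev n) 0)%:Z == m then nahm_term q w n else 0 : C^o)
    (w m / qpoch_inf q q).
Proof.
move=> q1; have Q0 n : qpoch q q n != 0 by exact: qpoch_neq0.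
set f := (X in has_sum _ X).
pose h (s : nat) : 2.-tuple nat :=
  if m is Posz k then [tuple (s + k)%N; s] else [tuple s; (s + absz m)%N].
have fh : f \o h = (fun s => w m * durfee_term q (absz m) s : C^o).
  apply/funext => s; rewrite /f /h /= /durfee_term /nahm_term.
  case: (m) => k /=; rewrite ifT.
  + have -> : (s + k)%N%:Z - s%:Z = Posz k by lia.
    by rewrite mulnC [qpoch _ _ (s + k) * _]mulrC.
  + by apply/eqP; lia.
  + have -> : s%:Z - (s + k.+1)%N%:Z = Negz k by lia.
    by [].
  + by apply/eqP; lia.
apply: (@has_sum_section _ _ _ h
  (fun n : 2.-tuple nat => minn (nth 0%N (rev n) 1) (nth 0%N (rev n) 0))).
- by move=> s; rewrite /h; case: (m) => k /=; lia.
- move=> n; rewrite /f; case: ifP => [/eqP|]; last by rewrite eqxx.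
  case: n => [[|u [|v []]]]//= i nm _; apply: val_inj; rewrite /h.
  by move: nm; case: (m) => k /= nm; congr [:: _; _]; lia.
- by rewrite fh; apply: bounded_sumsZ; exact: bounded_durfee_term.
- by rewrite fh; apply: has_sumZ; exact: has_sum_durfee.
Qed.

(** On reversed tuples: forget r after adding it to u and v.  This is the map
along whose fibers the coordinate r is summed out, and [split_seq] describes the
points of a fiber. *)
Definition merge_seq (s : seq nat) : seq nat :=
  if s is [:: v, u, r & l] then [:: (v + r)%N, (u + r)%N & l] else s.

Definition split_seq (s : seq nat) (r : nat) : seq nat :=
  if s is [:: v, u & l] then [:: (v - r)%N, (u - r)%N, r & l] else s.

Lemma size_merge_seq d (n : d.+3.-tuple nat) : size (rev (merge_seq (rev n))) == d.+2.
Proof.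
rewrite size_rev; have := size_rev n; rewrite size_tuple.
by case: (rev n) => [|v [|u [|r l]]]//= [->].
Qed.

Lemma size_split_seq d (n : d.+2.-tuple nat) r : size (rev (split_seq (rev n) r)) == d.+3.
Proof.
rewrite size_rev; have := size_rev n; rewrite size_tuple.
by case: (rev n) => [|v [|u l]]//= [->].
Qed.

Definition merge_tuple d (n : d.+3.-tuple nat) : d.+2.-tuple nat := Tuple (size_merge_seq n).
Definition split_tuple d (n : d.+2.-tuple nat) r : d.+3.-tuple nat := Tuple (size_split_seq n r).

(** The fiber over (U, V, l) is finite, consisting of the points
(U - r, V - r, r, l) with r <= min(U, V), and its sum is the q-Vandermonde
identity. *)
Lemma has_sum_nahm_fiberS (q : C) (w : int -> C) d (j : d.+2.-tuple nat) : `|q| < 1 ->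
  has_sum xpredT (fun n : d.+3.-tuple nat =>
      if merge_tuple n == j then nahm_term q w n else 0 : C^o)
    (nahm_term q w j).
Proof.
move=> q1; have Q0 n : qpoch q q n != 0 by exact: qpoch_neq0.
set f := (X in has_sum _ X).
have [V [U [l jE]]] : exists V U l, rev j = V :: U :: l.
  have := size_rev j; rewrite size_tuple.
  by case: (rev j) => [|V [|U l]]//= _; exists V, U, l.
have splitE r : rev (split_tuple j r) = [:: (V - r)%N, (U - r)%N, r & l].
  by rewrite /= revK jE.
pose L := [seq split_tuple j r | r <- iota 0 U.+1 & (r <= V)%N].
have -> : nahm_term q w j = \sum_(n <- L) f n.
  rewrite big_map big_filter big_mkcond -[iota _ _]/(index_iota 0 U.+1) big_mkord.
  rewrite (nahm_termE _ _ jE) -qvandermonde// mulr_sumr mulr_sumr.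
  apply: eq_bigr => r _; case: ifP => rV; last by rewrite !mulr0.
  have rU : (r <= U)%N by rewrite -ltnS.
  rewrite /f ifT; last first.
    apply/eqP/val_inj; rewrite /= revK jE /= !subnK// -jE revK//.
  rewrite (nahm_termE _ _ (splitE r)) /= !subnK//.
  have -> : (U - r)%N%:Z - (V - r)%N%:Z = U%:Z - V%:Z by lia.
  by field; rewrite !Q0.
apply: has_sum_finite.
  rewrite map_inj_uniq ?filter_uniq ?iota_uniq// => r r' /(congr1 val)/(congr1 rev).
  by rewrite !splitE => -[].
move=> n nL; rewrite /f; case: eqP => // nj; case/negP: nL.
have nE := size_rev n; rewrite size_tuple in nE.
case En : (rev n) nE => [|v [|u [|r l']]]//= _.
move: nj => /(congr1 val)/(congr1 rev); rewrite /= revK jE En /= => -[vV uU ll].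
apply/mapP; exists r; first by rewrite mem_filter mem_iota; lia.
apply: val_inj; rewrite -[LHS]revK -[RHS]revK splitE En -vV -uU ll.
by rewrite !addnK.
Qed.

Arguments has_sum_nahm_fiber0 {q} w m.
Arguments has_sum_nahm_fiberS {q} w {d} j.

(** With nonnegative terms the evaluation along fibers already proves
summability, from that of w. *)
Lemma bounded_nahm_pos (q : C) (w : int -> C) d : 0 <= q < 1 ->
  (forall m, 0 <= w m) -> bounded_sums w -> bounded_sums (@nahm_term q w d).
Proof.
move=> /andP[q0 q1] w0 bw.
have nq1 : `|q| < 1 by rewrite ger0_norm.
have Qp n : 0 < qpoch q q n.
  apply: prodr_gt0 => j _; rewrite -exprS subr_gt0 exprn_ilt1//.
have W0 l u v : 0 <= durfee_weight q l u v.
  elim: l u v => [|r l IH] u v /=; first by rewrite exprn_ge0.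
  by rewrite mulr_ge0 ?divr_ge0 ?exprn_ge0// ltW.
have N0 d' (n : d'.+2.-tuple nat) : 0 <= nahm_term q w n.
  by rewrite /nahm_term mulr_ge0// divr_ge0// mulr_ge0 ?(ltW (Qp _)).
elim: d => [|d IH].
  apply: (bounded_sums_fibers (F := fun m => w m / qpoch_inf q q : C^o) (N0 0%N)
    (fun m => has_sum_nahm_fiber0 w m nq1)).
  have := bounded_sumsZ (qpoch_inf q q)^-1 bw.
  by apply: le_bounded_sums => m; rewrite mulrC.
exact: (bounded_sums_fibers (N0 d.+1) (fun j => has_sum_nahm_fiberS w j nq1)).
Qed.

(** Each |1 / (q; q)_n| is at most 1 / (|q|; |q|)_n, so the terms are dominated
by those for |q| and |w|. *)
Lemma bounded_nahm (q : C) (w : int -> C) d : `|q| < 1 ->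
  bounded_sums w -> bounded_sums (@nahm_term q w d).
Proof.
move=> q1 bw.
have q01 : 0 <= `|q| < 1 by rewrite normr_ge0.
have bw' : bounded_sums (fun m => `|w m|).
  by apply: le_bounded_sums bw => m; rewrite normr_id.
apply: bounded_sums_norm (bounded_nahm_pos d q01 (fun m => normr_ge0 (w m)) bw').
have Qle n : `|(qpoch q q n)^-1| <= (qpoch `|q| `|q| n)^-1.
  rewrite normfV lef_pV2 ?posrE ?normr_gt0 ?qpoch_neq0//; last first.
    by apply: prodr_gt0 => j _; rewrite -exprS subr_gt0 exprn_ilt1.
  rewrite normr_prod; apply: ler_prod => j _.
  rewrite -!exprS subr_ge0 exprn_ile1 ?(ltW q1)//=.
  by rewrite -normrX -[X in X - _](@normr1 C) lerB_dist.
have Wle l u v : `|durfee_weight q l u v| <= durfee_weight `|q| l u v.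
  elim: l u v => [|r l IH] u v /=; first by rewrite normrX.
  by rewrite normrM ler_pM// normrM ler_pM// normrX.
move=> n; rewrite /nahm_term normrM ler_pM// !invfM normrM ler_pM//.
by rewrite normrM ler_pM.
Qed.

Lemma has_sum_nahm (q : C) (w : int -> C^o) (W : C^o) d : `|q| < 1 ->
  bounded_sums w -> has_sum xpredT w W ->
  has_sum xpredT (@nahm_term q w d) (W / qpoch_inf q q : C^o).
Proof.
move=> q1 bw hW; elim: d => [|d IH].
  apply: (has_sum_fibers (F := fun m => w m / qpoch_inf q q : C^o)
    (bounded_nahm 0 q1 bw) (fun m => has_sum_nahm_fiber0 w m q1)).
  apply: (eq_has_sum _ _ (has_sumZ (c := (qpoch_inf q q)^-1) hW)) => [m|]; exact: mulrC.
exact: (has_sum_fibers (bounded_nahm d.+1 q1 bw) (fun j => has_sum_nahm_fiberS w j q1) IH).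
Qed.

End NahmSum.

(** * The quadratic form of the matrix and its positivity *)

Section QuadraticForms.
Variable R : realType.
Local Notation C := R[i].

Section QuadraticForm.
Variable v : nat -> R.
Let tail d l : R := \sum_(l <= i < d) v i.

Lemma tail_recr d l : (l <= d)%N -> tail d.+1 l = tail d l + v d.
Proof. by move=> ld; rewrite /tail big_nat_recr. Qed.

Lemma sum_ord_const d (c : R) : d%:R * c = \sum_(l < d) c.
Proof. by rewrite sumr_const card_ord mulr_natl. Qed.

(** Both sides count v i once for every l <= i. *)
Lemma sum_tail d : \sum_(l < d) tail d l = \sum_(i < d) i.+1%:R * v i.
Proof.
elim: d => [|d IH]; first by rewrite !big_ord0.
rewrite !big_ord_recr /= -IH /tail big_nat1.
under eq_bigr => l _ do rewrite -/(tail _ _) tail_recr ?(ltnW (ltn_ord l))//.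
rewrite big_split /= sumr_const card_ord -mulr_natl -natr1; ring.
Qed.

(** The number min(i+1, j+1) counts the l with l <= i and l <= j. *)
Lemma min_form d :
  \sum_(i < d) \sum_(j < d) v i * (2 * minn i.+1 j.+1)%:R * v j =
  2 * \sum_(l < d) tail d l ^+ 2.
Proof.
elim: d => [|d IH]; first by rewrite !big_ord0 mulr0.
rewrite !big_ord_recr /= {2}/tail big_nat1 minnn.
under eq_bigr => i _ do rewrite big_ord_recr /= (minn_idPl _) ?ltnS ?(ltnW (ltn_ord i))//.
rewrite big_split /= IH.
have -> : \sum_(i < d) v d * (2 * minn d.+1 i.+1)%:R * v i = 2 * v d * \sum_(l < d) tail d l.
  rewrite sum_tail mulr_sumr; apply: eq_bigr => i _.
  by rewrite (minn_idPr _) ?ltnS ?(ltnW (ltn_ord i))// natrM; ring.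
have -> : \sum_(i < d) v i * (2 * i.+1)%:R * v d = 2 * v d * \sum_(l < d) tail d l.
  rewrite sum_tail mulr_sumr; apply: eq_bigr => i _.
  by rewrite natrM; ring.
have -> : \sum_(l < d) tail d.+1 l ^+ 2 =
    \sum_(l < d) tail d l ^+ 2 + 2 * v d * \sum_(l < d) tail d l + d%:R * v d ^+ 2.
  rewrite mulr_sumr (sum_ord_const d) -!big_split /=.
  by apply: eq_bigr => l _; rewrite tail_recr ?(ltnW (ltn_ord l))//; ring.
by rewrite (natrM _ 2 d.+1) -natr1; ring.
Qed.

Lemma Atilde_form d (a : R) :
  \sum_(i < d.+2) \sum_(j < d.+2) v i * Atilde_entry d.+2 a i.+1 j.+1 * v j =
  a * (v d - v d.+1) ^+ 2 +
  2 * (v d * v d.+1 + \sum_(l < d) (tail d l + v d) * (tail d l + v d.+1)).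
Proof.
have E1 i j : (i < d)%N -> (j < d)%N -> Atilde_entry d.+2 a i.+1 j.+1 = (2 * minn i.+1 j.+1)%:R.
  by rewrite /Atilde_entry subSS subn1 /= => -> ->.
have E2 i j : (i < d)%N -> (d <= j)%N -> Atilde_entry d.+2 a i.+1 j.+1 = i.+1%:R.
  by rewrite /Atilde_entry subSS subn1 /= => -> ; rewrite ltnNge => ->.
have E3 i j : (i < d)%N -> (d <= j)%N -> Atilde_entry d.+2 a j.+1 i.+1 = i.+1%:R.
  by rewrite /Atilde_entry subSS subn1 /= => -> ; rewrite ltnNge => ->.
have E4 i j : (d <= i)%N -> (d <= j)%N ->
    Atilde_entry d.+2 a i.+1 j.+1 = if i == j then a else d.+1%:R - a.
  by rewrite /Atilde_entry subSS subn1 /= eqSS !ltnNge => -> ->.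
rewrite !big_ord_recr /=.
under eq_bigr => i _.
  rewrite !big_ord_recr /= !E2//.
  under eq_bigr => j _ do rewrite E1//.
  over.
under [X in _ + (X + _ + _) + _]eq_bigr => j _ do rewrite E3//.
under [X in _ + (X + _ + _)]eq_bigr => j _ do rewrite E3//.
rewrite !E4// !eqxx (ltn_eqF (ltnSn d)) (gtn_eqF (ltnSn d)) !big_split /= min_form.
have S1 c : \sum_(i < d) v i * i.+1%:R * c = c * \sum_(l < d) tail d l.
  by rewrite sum_tail mulr_sumr; apply: eq_bigr => i _; ring.
have S2 c : \sum_(i < d) c * i.+1%:R * v i = c * \sum_(l < d) tail d l.
  by rewrite sum_tail mulr_sumr; apply: eq_bigr => i _; ring.
rewrite !S1 !S2.
have -> : \sum_(l < d) (tail d l + v d) * (tail d l + v d.+1) =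
    \sum_(l < d) tail d l ^+ 2 + (v d + v d.+1) * (\sum_(l < d) tail d l) + d%:R * (v d * v d.+1).
  rewrite mulr_sumr (sum_ord_const d) -!big_split /=.
  by apply: eq_bigr => l _; ring.
rewrite -natr1; ring.
Qed.

(** Pair the term (N + u)(N + v) = (N + (u+v)/2)^2 - (u-v)^2 / 4 for each of the
d values of N, and write u v = ((u+v)^2 - (u-v)^2) / 4: the coefficient of
(u-v)^2 drops from a to a - (d+1)/2. *)
Lemma Atilde_form_squares d (a : R) :
  \sum_(i < d.+2) \sum_(j < d.+2) v i * Atilde_entry d.+2 a i.+1 j.+1 * v j =
  (a - 2^-1 * d.+1%:R) * (v d - v d.+1) ^+ 2 + 2^-1 * (v d + v d.+1) ^+ 2 +
  2 * \sum_(l < d) (tail d l + (v d + v d.+1) / 2) ^+ 2.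
Proof.
rewrite Atilde_form.
have -> : \sum_(l < d) (tail d l + v d) * (tail d l + v d.+1) =
    \sum_(l < d) (tail d l + (v d + v d.+1) / 2) ^+ 2 - d%:R * ((v d - v d.+1) ^+ 2 / 4).
  rewrite (sum_ord_const d) -sumrB.
  by apply: eq_bigr => l _; field.
by rewrite -natr1; field.
Qed.

Lemma Atilde_form_gt0 d (a : R) : 2^-1 * d.+1%:R < a ->
  (exists2 i, (i < d.+2)%N & v i != 0) ->
  0 < \sum_(i < d.+2) \sum_(j < d.+2) v i * Atilde_entry d.+2 a i.+1 j.+1 * v j.
Proof.
move=> ha [i id vi]; rewrite Atilde_form_squares.
have ha' : 0 < a - 2^-1 * d.+1%:R by rewrite subr_gt0.
set X := _ * _ ^+ 2; set Y := _ * _ ^+ 2; set Z := 2 * _.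
have X0 : 0 <= X by rewrite mulr_ge0 ?sqr_ge0// ltW.
have Y0 : 0 <= Y by rewrite mulr_ge0 ?sqr_ge0.
have Z0 : 0 <= Z by rewrite mulr_ge0// sumr_ge0// => l _; rewrite sqr_ge0.
rewrite lt_neqAle !addr_ge0// andbT eq_sym paddr_eq0 ?addr_ge0// paddr_eq0//.
apply: contra vi => /andP[/andP[]].
rewrite /X mulf_eq0 (gt_eqF ha') sqrf_eq0 subr_eq0 => /eqP uw.
rewrite /Y mulf_eq0 invr_eq0 pnatr_eq0 sqrf_eq0 uw -mulr2n mulrn_eq0 /= => /eqP w0.
rewrite /Z mulf_eq0 pnatr_eq0 uw w0 addr0 mul0r psumr_eq0 => [/allP h|l _]; last by rewrite sqr_ge0.
have h0 l : (l <= d)%N -> tail d l = 0.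
  rewrite leq_eqVlt => /predU1P[->|ld]; first by rewrite /tail big_geq.
  have := h (Ordinal ld) (mem_index_enum _).
  by rewrite /= sqrf_eq0 addr0 => /eqP.
have [ild|] := ltnP i d.
  by have := h0 i (ltnW ild); rewrite /tail big_ltn// -/(tail d i.+1) h0// addr0 => ->.
rewrite leq_eqVlt => /predU1P[<-|di]; first by rewrite uw w0 eqxx.
have -> : i = d.+1 by apply/eqP; rewrite eqn_leq -ltnS id di.
by rewrite w0 eqxx.
Qed.

End QuadraticForm.

Lemma Atilde_mx_form d (a : R) (v : 'cV[R]_d.+2) :
  (v^T *m Atilde d.+2 a *m v) 0 0 =
  \sum_(i < d.+2) \sum_(j < d.+2) v (inord i) 0 * Atilde_entry d.+2 a i.+1 j.+1 * v (inord j) 0.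
Proof.
rewrite mxE exchange_big /=; apply: eq_bigr => j _; rewrite mxE mulr_suml.
by apply: eq_bigr => i _; rewrite !mxE !inord_val.
Qed.

Lemma posdef_Atilde d (a : R) : 2^-1 * d.+1%:R < a -> posdef (Atilde d.+2 a).
Proof.
move=> ha; split.
  apply/matrixP => i j; rewrite !mxE /Atilde_entry minnC eq_sym.
  by case: (_ <= _)%N; case: (_ <= _)%N.
move=> v v0; rewrite Atilde_mx_form.
apply: (@Atilde_form_gt0 (fun i => v (inord i) 0)) => //.
have [i vi] : exists i, v i 0 != 0.
  apply: contrapT => /forallNP vN; case/eqP: v0; apply/matrixP => i j.
  by rewrite mxE (ord1 j); apply/eqP/negPn/negP; exact: vN.
by exists i => //; rewrite inord_val.
Qed.

End QuadraticForms.

(** * Real powers of q *)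

Section RealPowers.
Variable R : realType.
Local Notation C := R[i].

Lemma cexpD (z w : C) : cexp (z + w) = cexp z * cexp w.
Proof.
case: z w => [a b] [c d]; rewrite /cexp /= expRD cosD sinD rmorphM.
apply/eqP; rewrite eq_complex /=; apply/andP; split; apply/eqP; ring.
Qed.

Lemma cexp0 : cexp (0 : C) = 1.
Proof.
by rewrite /cexp /= expR0 cos0 sin0 rmorph1 mul1r.
Qed.

Lemma qpowD (tau : C) (r s : R) : qpow tau (r + s) = qpow tau r * qpow tau s.
Proof. by rewrite /qpow -cexpD -!mulrDl -rmorphD mulrDr. Qed.

Lemma qpow0 (tau : C) : qpow tau 0 = 1.
Proof. by rewrite /qpow mulr0 !mul0r cexp0. Qed.

Lemma qpow_neq0 (tau : C) (r : R) : qpow tau r != 0.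
Proof.
apply/eqP => h; have := qpowD tau r (- r).
by rewrite subrr qpow0 h mul0r => /eqP; rewrite oner_eq0.
Qed.

Lemma qpowX (tau : C) (r : R) n : qpow tau r ^+ n = qpow tau (n%:R * r).
Proof.
elim: n => [|n IH]; first by rewrite mul0r qpow0.
by rewrite exprS IH -qpowD -nat1r mulrDl mul1r.
Qed.

Lemma norm_qpow_lt1 (tau : C) (r : R) : 0 < complex.Im tau -> 0 < r ->
  `|qpow tau r| < 1.
Proof.
move=> t0 r0; rewrite /qpow /cexp normrM.
set z := _ * tau.
have -> : `|cos (complex.Im z) +i* sin (complex.Im z)| = 1 :> C.
  by rewrite normc_def /= cos2Dsin2 sqrtr1.
rewrite mulr1 ger0_norm ?ler0c ?expR_ge0// -(rmorph1 (real_complex R)) ltcR.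
rewrite -expR0 ltr_expR /z; case: tau t0 {z} => [b c] /= c0.
rewrite [ltLHS](_ : _ = - (2 * pi * r * c)); last by ring.
by rewrite oppr_lt0 mulr_gt0// mulr_gt0// mulr_gt0// pi_gt0.
Qed.

End RealPowers.

(** * The summand, and the theta series over one parity class *)

Section Summand.
Variable R : realType.
Local Notation C := R[i].

Fixpoint durfee_exp (l : seq nat) (u v : nat) : nat :=
  if l is r :: l' then (u * v + durfee_exp l' (u + r) (v + r))%N else (u * v)%N.

Lemma durfee_weightE (q : C) l u v :
  durfee_weight q l u v = q ^+ durfee_exp l u v / \prod_(r <- l) qpoch q q r.
Proof.
elim: l u v => [|r l IH] u v /=; first by rewrite big_nil divr1.
by rewrite IH big_cons exprD invfM; ring.
Qed.

(** The recursion replaces u and v by u + r and v + r at every level, so level l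
contributes (N_l + u)(N_l + v), where N_l is the sum of the coordinates passed so
far. *)
Lemma durfee_exp_rev (f : nat -> nat) d u v :
  (durfee_exp (rev (mkseq f d)) u v)%:R = u%:R * v%:R +
  \sum_(l < d) (\sum_(l <= i < d) (f i)%:R + u%:R) * (\sum_(l <= i < d) (f i)%:R + v%:R) :> R.
Proof.
elim: d u v => [|d IH] u v; first by rewrite big_ord0 addr0 /= natrM.
have -> : rev (mkseq f d.+1) = f d :: rev (mkseq f d).
  by rewrite /mkseq -addn1 iotaD map_cat rev_cat.
rewrite /= natrD natrM IH; congr (_ + _); rewrite big_ord_recr /= big_nat1 addrC !natrD.
rewrite [u%:R + _]addrC [v%:R + _]addrC; congr (_ + _).
apply: eq_bigr => l _; rewrite big_nat_recr ?(ltnW (ltn_ord l))//=.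
by rewrite -!addrA.
Qed.

Lemma quadform_Atilde d (a : R) (n : d.+2.-tuple nat) :
  2^-1 * quadform (Atilde d.+2 a) n =
  a / 2 * ((nth 0 n d)%:R - (nth 0 n d.+1)%:R) ^+ 2 +
  (durfee_exp (rev (take d n)) (nth 0 n d) (nth 0 n d.+1))%:R.
Proof.
have -> : take d n = mkseq (nth 0 n) d.
  apply: (@eq_from_nth _ 0); rewrite ?size_mkseq size_takel ?size_tuple ?leqW// => i id.
  by rewrite nth_take// nth_mkseq.
rewrite durfee_exp_rev /quadform Atilde_mx_form.
pose f i : R := (nth 0 n i)%:R.
rewrite [X in 2^-1 * X](_ : _ = \sum_(i < d.+2) \sum_(j < d.+2)
    f i * Atilde_entry d.+2 a i.+1 j.+1 * f j).
  by rewrite Atilde_form /f; field.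
apply: eq_bigr => i _; apply: eq_bigr => j _.
by rewrite !mxE !inord_val /f !(tnth_nth 0).
Qed.

Lemma summand_nahm_term d (a : R) (tau x : C) (n : d.+2.-tuple nat) :
  summand a tau x n = nahm_term (qpow tau 1) (theta_term x (qpow tau (a / 2))) n.
Proof.
have sn := size_tuple n.
have nE : rev n = nth 0 n d.+1 :: nth 0 n d :: rev (take d n).
  rewrite -{1}(cat_take_drop d n) (drop_nth 0%N) ?sn// (drop_nth 0%N) ?sn//.
  by rewrite drop_oversize ?sn// rev_cat.
rewrite (nahm_termE _ _ nE) durfee_weightE /summand /coord1 subSS subn0 /=.
set u := nth 0 n d; set v := nth 0 n d.+1; set l := rev (take d n).
have -> : \prod_(i < d.+2) qpoch (qpow tau 1) (qpow tau 1) (tnth n i) =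
    qpoch (qpow tau 1) (qpow tau 1) v * (qpoch (qpow tau 1) (qpow tau 1) u *
    \prod_(r <- l) qpoch (qpow tau 1) (qpow tau 1) r).
  rewrite -(big_tuple _ _ n xpredT (fun r => qpoch (qpow tau 1) (qpow tau 1) r)).
  by rewrite -big_rev nE !big_cons.
rewrite quadform_Atilde -/u -/v -/l qpowD /theta_term !qpowX mulr1.
have -> : (`|(u%:Z - v%:Z)%R| ^ 2)%N%:R * (a / 2) = a / 2 * (u%:R - v%:R) ^+ 2 :> R.
  rewrite mulrC; congr (_ * _).
  have -> : (`|(u%:Z - v%:Z)%R| ^ 2)%N%:R = ((`|(u%:Z - v%:Z)%R| ^ 2)%N%:Z)%:~R :> R by [].
  by rewrite abs_sqr intrM rmorphB /= expr2.
by rewrite !invfM; ring.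
Qed.

Definition even_part (w : int -> C^o) (m : int) : C^o := if (m %% 2 == 0)%Z then w m else 0.
Definition odd_part (w : int -> C^o) (m : int) : C^o := if (m %% 2 == 0)%Z then 0 else w m.

Lemma theta_term_even (x p : C) (j : int) :
  theta_term x p (2 * j) = theta_term (x ^+ 2) (p ^+ 4) j.
Proof.
rewrite /theta_term (exprnP x) exprz_exp -exprM; congr (_ * _ ^+ _).
by rewrite abszM expnMn.
Qed.

(** Expand (2j+1)^2 = 4j^2 + 4j + 1: the linear part 4j is absorbed in z. *)
Lemma theta_term_odd (x p : C) (j : int) : x != 0 -> p != 0 ->
  theta_term x p (2 * j + 1) = p * x * theta_term (p ^+ 4 * x ^+ 2) (p ^+ 4) j.
Proof.
move=> x0 p0; rewrite /theta_term expfzDr// expr1z exprzMl ?unitfE ?expf_neq0//.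
have -> : p ^+ (`|(2 * j + 1)%R| ^ 2) = p * ((p ^+ 4) ^ j * (p ^+ 4) ^+ (`|j| ^ 2)) :> C.
  rewrite -exprM (exprnP p 4) exprz_exp (exprnP p (4 * _)) (exprnP p (_ ^ _)).
  rewrite -expfzDr// -{2}[p]expr1z -expfzDr//; congr (_ ^ _).
  by rewrite PoszM !abs_sqr; ring.
by rewrite (exprnP x) exprz_exp; ring.
Qed.

Lemma has_sum_jacobi_even (x p : C) : x != 0 -> `|p| < 1 ->
  has_sum xpredT (even_part (theta_term x p))
    (qpoch_inf (- (x ^+ 2 * p ^+ 4)) (p ^+ 8) * qpoch_inf (- (x ^- 2 * p ^+ 4)) (p ^+ 8)
     * qpoch_inf (p ^+ 8) (p ^+ 8) : C^o).
Proof.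
move=> x0 p1; have p4 : `|p ^+ 4| < 1 by rewrite normrX exprn_ilt1.
have fh : even_part (theta_term x p) \o (fun j => 2 * j) = theta_term (x ^+ 2) (p ^+ 4).
  by apply/funext => j; rewrite /= /even_part ifT ?theta_term_even//; lia.
have x20 : x ^+ 2 != 0 by rewrite expf_neq0.
apply: (@has_sum_section _ _ _ (fun j => 2 * j) (fun m => (m %/ 2)%Z)).
- by move=> j; lia.
- by move=> m; rewrite /even_part; case: ifP => [|_]; rewrite ?eqxx//; lia.
- by rewrite fh; exact: bounded_theta_term.
- by rewrite fh; have := has_sum_jacobi p4 x20; rewrite -exprM.
Qed.

Lemma has_sum_jacobi_odd (x p : C) : x != 0 -> p != 0 -> `|p| < 1 ->
  has_sum xpredT (odd_part (theta_term x p))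
    (p * x * (qpoch_inf (- (p ^+ 8 * x ^+ 2)) (p ^+ 8) * qpoch_inf (- x ^- 2) (p ^+ 8)
     * qpoch_inf (p ^+ 8) (p ^+ 8)) : C^o).
Proof.
move=> x0 p0 p1; have p4 : `|p ^+ 4| < 1 by rewrite normrX exprn_ilt1.
have fh : odd_part (theta_term x p) \o (fun j => 2 * j + 1) =
    (fun j => p * x * theta_term (p ^+ 4 * x ^+ 2) (p ^+ 4) j : C^o).
  by apply/funext => j; rewrite /= /odd_part ifF ?theta_term_odd//; lia.
have z0 : p ^+ 4 * x ^+ 2 != 0 by rewrite mulf_neq0 ?expf_neq0.
apply: (@has_sum_section _ _ _ (fun j => 2 * j + 1) (fun m => (m %/ 2)%Z)).
- by move=> j; lia.
- by move=> m; rewrite /odd_part; case: ifP => [_|]; rewrite ?eqxx//; lia.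
- by rewrite fh; apply: bounded_sumsZ; exact: bounded_theta_term.
- rewrite fh; apply: has_sumZ; have := has_sum_jacobi p4 z0; rewrite -exprM.
  have -> : p ^+ 4 * x ^+ 2 * p ^+ 4 = p ^+ 8 * x ^+ 2 by ring.
  by have -> : (p ^+ 4 * x ^+ 2)^-1 * p ^+ 4 = x ^- 2 by field; rewrite x0 p0.
Qed.

End Summand.

(** * The three identities *)

Unset Implicit Arguments.

Theorem theorem1p2 (R : realType) (k : nat) (a : R)
    (hk : (2 <= k)%N) (ha : 2^-1 * (k - 1)%:R < a) :
  posdef (Atilde k a) /\
  forall tau x : R[i], 0 < complex.Im tau -> x != 0 ->
  [/\ has_sum
        (fun n : k.-tuple nat => coord1 n (k - 1) == coord1 n k %[mod 2])
        (summand a tau x)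
        (qpochs_inf [:: - qpow tau (2 * a) * x ^+ 2;
                        - qpow tau (2 * a) * x ^- 2;
                        qpow tau (4 * a)] (qpow tau (4 * a))
         / qpoch_inf (qpow tau 1) (qpow tau 1)),
      has_sum
        (fun n : k.-tuple nat => coord1 n (k - 1) != coord1 n k %[mod 2])
        (summand a tau x)
        (qpow tau (2^-1 * a) * x
         * (qpochs_inf [:: - qpow tau (4 * a) * x ^+ 2;
                           - x ^- 2;
                           qpow tau (4 * a)] (qpow tau (4 * a))
            / qpoch_inf (qpow tau 1) (qpow tau 1)))
    & has_sum
        (fun n : k.-tuple nat => true)
        (summand a tau x)
        (qpochs_inf [:: - x * qpow tau (a / 2);
                        - qpow tau (a / 2) * x^-1;
                        qpow tau a] (qpow tau a)
         / qpoch_inf (qpow tau 1) (qpow tau 1))].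
Proof.
case: k hk ha => [//|[//|d]] _; rewrite subSS subn0 => ha.
split=> [|tau x tau0 x0]; first exact: posdef_Atilde.
have a0 : 0 < a by apply: le_lt_trans ha; rewrite mulr_ge0.
have q1 := norm_qpow_lt1 tau0 (@ltr01 R).
set p := qpow tau (a / 2).
have p1 : `|p| < 1 by apply: norm_qpow_lt1; rewrite // divr_gt0.
have p0 : p != 0 by exact: qpow_neq0.
have p2E : qpow tau a = p ^+ 2 by rewrite qpowX; congr qpow; field.
have p4E : qpow tau (2 * a) = p ^+ 4 by rewrite qpowX; congr qpow; field.
have p8E : qpow tau (4 * a) = p ^+ 8 by rewrite qpowX; congr qpow; field.
have bt := bounded_theta_term p1 x0.
have be : bounded_sums (even_part (theta_term x p)).
  by apply: le_bounded_sums bt => m; rewrite /even_part; case: ifP; rewrite ?normr0.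
have bo : bounded_sums (odd_part (theta_term x p)).
  by apply: le_bounded_sums bt => m; rewrite /odd_part; case: ifP; rewrite ?normr0.
have parity (n : d.+2.-tuple nat) : (coord1 n d.+1 == coord1 n d.+2 %[mod 2]) =
    ((((nth 0%N (rev n) 1)%:Z - (nth 0%N (rev n) 0)%:Z)%R %% 2)%Z == 0).
  rewrite /coord1 !nth_rev ?size_tuple// subn1 subn2 /=; lia.
rewrite !qpochs_inf3 p2E p4E p8E.
split.
- apply: has_sum_mkcond.
  apply: (eq_has_sum _ _ (has_sum_nahm d q1 be (has_sum_jacobi_even x0 p1))) => [n|].
    rewrite summand_nahm_term parity /nahm_term /even_part.
    by case: ifP; rewrite ?mul0r.
  by rewrite !mulNr [p ^+ 4 * _]mulrC [p ^+ 4 * _]mulrC !mulrA.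
- apply: has_sum_mkcond.
  apply: (eq_has_sum _ _ (has_sum_nahm d q1 bo (has_sum_jacobi_odd x0 p0 p1))) => [n|].
    rewrite summand_nahm_term parity /nahm_term /odd_part.
    by case: ifP; rewrite ?mul0r.
  by rewrite mulNr [2^-1 * a]mulrC -/p !mulrA.
- apply: (eq_has_sum _ _ (has_sum_nahm d q1 bt (has_sum_jacobi p1 x0))) => [n|].
    by rewrite summand_nahm_term.
  by rewrite !mulNr [p * x^-1]mulrC !mulrA.
Qed.
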